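(* The following four statements are equivalent: (1) $\mathfrak{m}_c = \mathfrak{d}$; (2) independent families with q-filters exist $\mathfrak{d}$-generically, i.e. every independent family $I$ on $\omega$ with $|I| < \mathfrak{d}$ is contained in some independent family $I'\supseteq I$ on $\omega$ that has a q-filter; (3) everywhere q-independent families exist $\mathfrak{d}$-generically, i.e. every independent family $I$ on $\omega$ with $|I| < \mathfrak{d}$ is contained in some everywhere q-independent family $I'\supseteq I$; (4) q-independent families exist $\mathfrak{d}$-generically, i.e. every independent family $I$ on $\omega$ with $|I| < \mathfrak{d}$ is contained in some q-independent family $I'\supseteq I$.
   Context: A ''function on $\omega$'' means a function $f:\omega\to\omega$. For $A \subseteq \omega$ let $A^0 = A$ and $A^1 = \omega\setminus A$. For a set $I$, $\mathrm{FF}(I)$ is the set of functions $h$ with finite domain $\mathrm{dom}(h)\subseteq I$ and values in $\{0,1\}$; for $h \in \mathrm{FF}(I)$ let $I^h = \bigcap\{A^{h(A)} : A \in \mathrm{dom}(h)\}$ (with $I^\emptyset=\omega$). An infinite family $I$ of subsets of $\omega$ is independent if $I^h \neq \emptyset$ for every $h \in \mathrm{FF}(I)$; all independent families considered are infinite. The envelope of $I$ is $\mathrm{ENV}(I) = \{I^h : h \in \mathrm{FF}(I)\}$. An independent family $I$ is q-independent if for every finite-to-one function $f$ on $\omega$ there is $E \in \mathrm{ENV}(I)$ such that $f\restriction E$ is one-to-one. It is everywhere q-independent if for every finite-to-one function $f$ on $\omega$ and every $h \in \mathrm{FF}(I)$ there is $k \in \mathrm{FF}(I)$ with $h \subseteq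 k$ such that $f \restriction I^k$ is one-to-one. For an independent family $I$, $\mathrm{Fil}_I$ is the filter of all $A \subseteq \omega$ such that every $h \in \mathrm{FF}(I)$ can be extended to some $k \in \mathrm{FF}(I)$, $h\subseteq k$, with $I^k \subseteq A$. $I$ has a q-filter if for every finite-to-one function $f$ on $\omega$ there is $A \in \mathrm{Fil}_I$ with $f\restriction A$ one-to-one. A function $f$ dominates $g$ if $f(n) > g(n)$ for all $n$; $\mathfrak{d}$ is the minimum cardinality of a family $F$ of functions on $\omega$ such that every function on $\omega$ is dominated by some member of $F$. $\mathfrak{m}_c$ is the minimum cardinality of a family $H$ of functions on $\omega$ such that for every function $g$ on $\omega$ there is $h \in H$ with $g(n) \neq h(n)$ for all $n \in \omega$. *)

(* Defs.v *)
From HB Require Import structures.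
From mathcomp Require Import all_boot finmap.
From mathcomp Require Import boolp classical_sets functions cardinality.

Set Implicit Arguments.
Unset Strict Implicit.
Unset Printing Implicit Defensive.

Local Open Scope classical_set_scope.
Local Open Scope card_scope.
Local Open Scope fmap_scope.

Definition card_lt T U (A : set T) (B : set U) := A #<= B /\ ~ (B #<= A).

(* There is no type of cardinals: the minimum cardinality of the members of C is
   represented by a member attaining it, unique up to equipotence. *)
Definition attains_min_card T (C : set (set T)) : set (set T) :=
  [set A | C A /\ forall B, C B -> A #<= B].

(* Zorn's lemma on sets X of choice functions through C, any two of which differ
   on every member of C: a maximal X is in bijection with some member of C. *)
Lemma attains_min_card_exists T (C : set (set T)) :
  C !=set0 -> attains_min_card C !=set0.
Proof.
move=> [A0 CA0].
pose P : set (set ({B : set T | C B} -> T)) := [set X |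
  (forall x j, X x -> sval j (x j)) /\
  (forall x y j, X x -> X y -> x j = y j -> x = y)].
have [|X [[XC Xinj] Xmax]] := @Zorn_bigcup _ P.
  move=> F FP Ftot; split=> [x j [X FX Xx]|x y j [X FX Xx] [Y FY Yy] xy].
    by have [+ _] := FP _ FX; exact.
  have [XY|YX] := Ftot _ _ FX FY.
    by have [_ +] := FP _ FY; move=> /(_ x y j); apply=> //; exact: XY.
  by have [_ +] := FP _ FX; move=> /(_ x y j); apply=> //; exact: YX.
have Xeq j : [set x j | x in X] #= X.
  by apply: inj_card_eq => x y /set_mem Xx /set_mem Xy; exact: Xinj.
have Xle B : C B -> X #<= B.
  move=> CB; rewrite -(card_le_eql (Xeq (exist _ B CB))).
  by apply: subset_card_le => _ [x Xx <-]; exact: (XC x (exist _ B CB)).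
have [j Xj] : exists j, sval j `<=` [set x j | x in X].
  apply: contrapT => /forallNP noj.
  have /choice[x xP] j : exists t, sval j t /\ ~ [set x j | x in X] t.
    by have /existsNP[t /not_implyP tP] := noj j; exists t.
  have nXx : ~ X x by move=> Xx; have [_] := xP (exist _ A0 CA0); apply; exists x.
  apply: (Xmax (x |` X)); first split.
  - by move=> y Xy; right.
  - by move=> /(_ x (or_introl erefl)).
  - split=> [y j [->|]|y z j]; [by have [] := xP j|exact: XC|].
    move=> [->|Xy] [->|Xz] //; last exact: Xinj.
    + by move=> e; have [_ []] := xP j; exists z.
    + by move=> e; have [_ []] := xP j; exists y.
exists (sval j); split=> [|B CB]; first exact: (svalP j).
apply: card_le_trans (subset_card_le Xj) _.
by rewrite (card_le_eql (Xeq j)); exact: Xle.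
Qed.

Definition dominating : set (set (nat -> nat)) :=
  [set F | forall g, exists2 f, F f & forall n, g n < f n].

Definition evading : set (set (nat -> nat)) :=
  [set H | forall g, exists2 h, H h & forall n, g n <> h n].

Definition frak_d : set (nat -> nat) := xget set0 (attains_min_card dominating).

Definition frak_mc : set (nat -> nat) := xget set0 (attains_min_card evading).

Lemma frak_dP : attains_min_card dominating frak_d.
Proof.
apply: xgetPex; apply: attains_min_card_exists; exists setT => g.
by exists (fun n => (g n).+1).
Qed.

Lemma frak_mcP : attains_min_card evading frak_mc.
Proof.
apply: xgetPex; apply: attains_min_card_exists; exists setT => g.
by exists (fun n => (g n).+1) => // n; exact: n_Sn.
Qed.

Definition finite_to_one (f : nat -> nat) :=
  forall m, finite_set (f @^-1` [set m]).

(* The value 0 is encoded as false and the value 1 as true. *)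
Definition spow (A : set nat) (b : bool) : set nat := if b then ~` A else A.

Definition FF (I : set (set nat)) : set {fmap set nat -> bool} :=
  [set h | [set` domf h] `<=` I].

Definition fextends (h k : {fmap set nat -> bool}) :=
  forall (A : set nat) (b : bool), h.[? A] = Some b -> k.[? A] = Some b.

Definition cell (h : {fmap set nat -> bool}) : set nat :=
  \bigcap_(A : domf h) spow (val A) (h A).

Definition ENV (I : set (set nat)) : set (set nat) := [set cell h | h in FF I].

Definition independent (I : set (set nat)) :=
  infinite_set I /\ forall h, FF I h -> cell h !=set0.

Definition q_independent (I : set (set nat)) :=
  independent I /\
  forall f, finite_to_one f -> exists2 E, ENV I E & set_inj E f.

Definition everywhere_q_independent (I : set (set nat)) :=
  independent I /\
  forall f h, finite_to_one f -> FF I h ->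
    exists k, [/\ FF I k, fextends h k & set_inj (cell k) f].

Definition Fil (I : set (set nat)) : set (set nat) :=
  [set A | forall h, FF I h ->
    exists k, [/\ FF I k, fextends h k & cell k `<=` A]].

Definition has_q_filter (I : set (set nat)) :=
  forall f, finite_to_one f -> exists2 A, Fil I A & set_inj A f.

Definition exist_d_generically (P : set (set nat) -> Prop) :=
  forall I, independent I -> card_lt I frak_d ->
    exists I', I `<=` I' /\ P I'.

(* Main.v *)
Require Import Defs.
From mathcomp Require Import all_boot finmap.
From mathcomp Require Import boolp classical_sets functions cardinality wochoice.

(** If [frak_mc = frak_d], a family of fewer than
    [frak_mc] functions [h] admits a guess [g] meeting each [h] somewhere. Guessing,
    at stage n, a sparse list of 2n + 1 points of a cell gives a sparse set A
    meeting every cell of a small independent family J, on which infinitely many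
    new sets Y n, all contained in A, can be made independent over J. Any finite
    partial function omits some Y n, hence extends to one whose cell lies in A:
    the set A is in the filter of J and the Y n, and stays there when the family
    grows. As a map is injective on a set that is sparse enough, it suffices to do
    this along a dominating family, well-ordered so that all proper initial segments
    have cardinality less than [frak_d].

    Conversely, if [frak_mc < frak_d], some b is not dominated by the functions
    arising from finite sets of members of an evading family. The set [nat] is cut
    into finite blocks, the N-th one being made of the sequences t of length N with
    values at most b N, and every h gives the set of the t agreeing somewhere with
    (a code of) h. These sets are independent since b is large often enough. A set
    meeting each block at most once amounts to one function g, so it misses the set
    attached to a function h evading g, whereas a cell on which the block index is
    injective would have to meet it. *)

Set Implicit Arguments.
Unset Strict Implicit.
Unset Printing Implicit Defensive.

Local Open Scope classical_set_scope.
Local Open Scope card_scope.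

(** * Arithmetic of infinite cardinals *)

Lemma card_le_inj T U (A : set T) (B : set U) (f : T -> U) :
  (forall x, A x -> B (f x)) ->
  (forall x y, A x -> A y -> f x = f y -> x = y) -> A #<= B.
Proof.
move=> fB finj; have fA : f @` A #= A.
  by apply: inj_card_eq => x y /set_mem Ax /set_mem Ay; exact: finj.
by rewrite -(card_le_eql fA); apply: subset_card_le => _ [x Ax <-]; exact: fB.
Qed.

Lemma card_le_injE T (U : pointedType) (A : set T) (B : set U) :
  A #<= B -> exists f : T -> U,
  (forall x, A x -> B (f x)) /\
  (forall x y, A x -> A y -> f x = f y -> x = y).
Proof.
move=> /pcard_leP[f]; exists f; split=> [x Ax|x y Ax Ay]; first exact: funS.
by apply: (@inj _ _ A f); exact: mem_set.
Qed.

(** A family of sets has a member of least cardinality; apply this to the copies of [A] and [B] in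
    the sum type. *)
Lemma card_le_total T U (A : set T) (B : set U) : A #<= B \/ B #<= A.
Proof.
have lA : @inl T U @` A #= A by apply: inj_card_eq => ? ? _ _ [].
have rB : @inr T U @` B #= B by apply: inj_card_eq => ? ? _ _ [].
have [] := @attains_min_card_exists _ [set inl @` A; inr @` B].
  by exists (inl @` A); left.
move=> _ [[->|->] minC]; [left|right].
  by have := minC _ (or_intror erefl); rewrite (card_le_eql lA) (card_le_eqr rB).
by have := minC _ (or_introl erefl); rewrite (card_le_eql rB) (card_le_eqr lA).
Qed.

Lemma card_le_setX T U (T' U' : pointedType)
    (A : set T) (B : set U) (A' : set T') (B' : set U') :
  A #<= A' -> B #<= B' -> A `*` B #<= A' `*` B'.
Proof.
move=> /card_le_injE[f [fA finj]] /card_le_injE[g [gB ginj]].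
apply: (@card_le_inj _ _ _ _ (fun p => (f p.1, g p.2))).
  by move=> [x y] [/= Ax By]; split; [exact: fA|exact: gB].
by move=> [x y] [x' y'] [/= Ax By] [/= Ax' By'] [/finj-> // /ginj->].
Qed.

(* Partial injective pairing functions R on a subset of A are given by their
   graph; the domain is read off the diagonal, so that unions of chains are
   plain unions. *)
Definition pairing_dom T (R : set (T * T * T)) : set T :=
  [set x | exists z, R (x, x, z)].

Definition pairing T (A : set T) (R : set (T * T * T)) :=
  [/\ forall x y z, R (x, y, z) ->
        [/\ pairing_dom R x, pairing_dom R y & pairing_dom R z],
      forall x y, pairing_dom R x -> pairing_dom R y -> exists z, R (x, y, z),
      forall x y z z', R (x, y, z) -> R (x, y, z') -> z = z',
      forall x y x' y' z, R (x, y, z) -> R (x', y', z) -> x = x' /\ y = y' &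
      pairing_dom R `<=` A].

Lemma pairing_bigcup T (A : set T) (F : set (set (T * T * T))) :
  (forall R, F R -> pairing A R) -> total_on F subset ->
  pairing A (\bigcup_(R in F) R).
Proof.
move=> FP Ftot; set W := \bigcup_(R in F) R.
have domW R : F R -> pairing_dom R `<=` pairing_dom W.
  by move=> FR x [z Rz]; exists z, R.
have two a b : W a -> W b -> exists R, [/\ F R, R a & R b].
  move=> [R FR Ra] [S FS Sb]; have [RS|SR] := Ftot _ _ FR FS.
    by exists S; split=> //; exact: RS.
  by exists R; split=> //; exact: SR.
split.
- move=> x y z [R FR Rxyz]; have [+ _ _ _ _] := FP _ FR.
  by move=> /(_ _ _ _ Rxyz)[? ? ?]; split; exact: domW FR _ _.
- move=> x y [z xz] [z' yz']; have [R [FR Rx Ry]] := two _ _ xz yz'.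
  have [_ + _ _ _] := FP _ FR => /(_ x y)[||w Rw]; first by exists z.
    by exists z'.
  by exists w, R.
- move=> x y z z' a b; have [R [FR Ra Rb]] := two _ _ a b.
  by have [_ _ fR _ _] := FP _ FR; exact: fR Ra Rb.
- move=> x y x' y' z a b; have [R [FR Ra Rb]] := two _ _ a b.
  by have [_ _ _ iR _] := FP _ FR; exact: iR Ra Rb.
- move=> x [z [R FR Rx]]; have [_ _ _ _] := FP _ FR; apply.
  by exists z.
Qed.

(** Zorn's lemma runs over the sets [X] whose union with [R0], a pairing on a countable subset of
    [A], is a pairing: this settles the empty chain and makes the domain infinite. *)
Lemma pairing_maximal (T : pointedType) (A : set T) : infinite_set A ->
  exists R, [/\ pairing A R, infinite_set (pairing_dom R) &
    forall S, pairing A S -> R `<=` S -> S `<=` R].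
Proof.
move=> /infiniteP /card_le_injE[e [eA einj]].
pose R0 : set (T * T * T) :=
  [set p | exists i j, p = (e i, e j, e (choice.pickle (i, j)))].
have einj' i j : e i = e j -> i = j by move=> /einj; exact.
have domR0 : pairing_dom R0 = range e.
  apply/seteqP; split=> [x [z [i [j [-> _ _]]]]|_ [i _ <-]]; first by exists i.
  by exists (e (choice.pickle (i, i))), i, i.
have R0P : pairing A R0.
  split; rewrite ?domR0.
  - by move=> x y z [i [j [-> -> ->]]]; split; eexists.
  - by move=> x y [i _ <-] [j _ <-]; exists (e (choice.pickle (i, j))), i, j.
  - move=> x y z z' [i [j [-> -> ->]]] [i' [j' [/einj' <- /einj' <- ->]]].
    by [].
  - move=> x y x' y' z [i [j [-> -> ->]]] [i' [j' [-> ->]]].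
    by move=> /einj' /(pcan_inj choice.pickleK) [-> ->].
  - by move=> _ [i _ <-]; exact: eA.
pose P := [set X | pairing A (X `|` R0)].
have [F FP Ftot|X [PX Xmax]] := @Zorn_bigcup _ P.
  pose F' := R0 |` [set X `|` R0 | X in F].
  have -> : P (\bigcup_(X in F) X) = pairing A (\bigcup_(X in F') X).
    congr pairing; apply/seteqP; split=> [p [[X FX Xp]|R0p]|].
    - by exists (X `|` R0); [right; exists X|left].
    - by exists R0; [left|].
    - move=> p [_ [->|[X FX <-]]]; first by right.
      by move=> [Xp|]; [left; exists X|right].
  apply: pairing_bigcup => [_ [->|[X /FP PX <-]]|] //.
  move=> _ _ [->|[X FX <-]] [->|[Y FY <-]].
  - by left.
  - by left=> p; right.
  - by right=> p; right.
  - by have [XY|YX] := Ftot _ _ FX FY; [left|right]; apply: setSU.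
exists (X `|` R0); split=> //.
  apply/infiniteP; apply: (@card_le_inj _ _ _ _ e) => [i _|i j _ _ /einj' //].
  by exists (e (choice.pickle (i, i))); right; exists i, i.
move=> S SP RS; apply: contrapT => nSR; apply: (Xmax S).
  split; last by move=> SX; apply: nSR; apply: subset_trans SX _; exact: subsetUl.
  by apply: subset_trans RS; exact: subsetUl.
rewrite /P /= (_ : S `|` R0 = S) //; apply/seteqP; split=> [p [//|R0p]|p Sp].
  by apply: RS; right.
by left.
Qed.

(* If a maximal pairing has domain B and A `\` B is at least as large as B, the
   pairs of B `|` C outside B x B can be coded injectively in C, for C a copy of B in
   A `\` B. *)
Lemma card_setX_self (T : pointedType) (A : set T) : infinite_set A ->
  A `*` A #<= A.
Proof.
move=> /pairing_maximal[R [[Rdom Rtot Rfun Rinj RA] Binf Rmax]].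
set B := pairing_dom R in Binf RA.
have /choice[q' qP'] (p : T * T) : exists z, B p.1 -> B p.2 -> R (p, z).
  have [[B1 B2]|nB] := pselect (B p.1 /\ B p.2).
    by have [z Rz] := Rtot _ _ B1 B2; exists z; case: p {B1 B2} Rz.
  by exists point => B1 B2; case: nB.
pose q x y := q' (x, y).
have qP x y : B x -> B y -> R (x, y, q x y) by move=> Bx By; exact: qP'.
have qB x y : B x -> B y -> B (q x y).
  by move=> Bx By; have [] := Rdom _ _ _ (qP _ _ Bx By).
have qinj x y x' y' : B x -> B y -> B x' -> B y' -> q x y = q x' y' ->
    x = x' /\ y = y'.
  move=> Bx By Bx' By' e; have := qP _ _ Bx' By'; rewrite -e.
  exact/Rinj/qP.
have [e [eB einj]] := card_le_injE ((infiniteP B).1 Binf).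
have e01 : e 0 <> e 1 by move=> /einj; move=> /(_ I I).
have {}eB i : B (e i) by exact: eB.
(* First coordinates [e 0] and [e 1] give two disjoint copies of [B] inside [B]: one receives [B]
   itself, the other, through [j], the points outside [B]. *)
pose fold (j : T -> T) x := if `[< B x >] then q (e 0) x else q (e 1) (j x).
have fold_inj j (D : set T) : (forall x, D x -> ~ B x -> B (j x)) ->
    (forall x y, D x -> D y -> ~ B x -> ~ B y -> j x = j y -> x = y) ->
    (forall x, D x -> B (fold j x)) /\
    (forall x y, D x -> D y -> fold j x = fold j y -> x = y).
  move=> jB jinj; split=> [x Dx|x y Dx Dy]; rewrite /fold.
    by case: asboolP => Bx; apply: qB => //; exact: jB.
  case: asboolP => Bx; case: asboolP => By.
  - by move=> /qinj[].
  - by move=> /qinj[]//; exact: jB.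
  - by move=> /qinj[]//; [exact: jB|move=> /esym].
  - by move=> /qinj[]//; [exact: jB|exact: jB|move=> _; exact: jinj].
have BAX : B `*` B #<= A.
  apply: (@card_le_inj _ _ _ _ (fun p => q p.1 p.2)).
    by move=> [x y] [/= Bx By]; exact/RA/qB.
  by move=> [x y] [x' y'] [/= Bx By] [/= Bx' By'] /qinj[]// -> ->.
have [AB|BA] := card_le_total (A `\` B) B.
  have [j [jB jinj]] := card_le_injE AB.
  have [||fB finj] := fold_inj j A.
  - by move=> x Ax Bx; exact: jB.
  - by move=> x y Ax Ay Bx By; exact: jinj.
  apply: card_le_trans BAX.
  by apply: card_le_setX; apply: (@card_le_inj _ _ _ _ (fold j)).
have [i [iAB iinj]] := card_le_injE BA.
pose C := i @` B.
have CB x : C x -> ~ B x by move=> [y /iAB[_ +] <-].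
have /choice[j jP] (c : T) : exists b, C c -> B b /\ i b = c.
  have [[b Bb <-]|nC] := pselect (C c); first by exists b.
  by exists point.
have [||rB rinj] := fold_inj j (B `|` C).
- by move=> x [//|/jP[]].
- move=> x y [//|Cx] [//|Cy] _ _ e'.
  by rewrite -(jP _ Cx).2 -(jP _ Cy).2 e'.
set r := fold j in rB rinj.
pose k x y := i (q (r x) (r y)).
pose S : set (T * T * T) := R `|` [set p | [/\ (B `|` C) p.1.1, (B `|` C) p.1.2,
  ~ (B p.1.1 /\ B p.1.2) & p.2 = k p.1.1 p.1.2]].
have kC x y : (B `|` C) x -> (B `|` C) y -> C (k x y).
  by move=> Dx Dy; exists (q (r x) (r y)) => //; apply: qB; exact: rB.
have kinj x y x' y' : (B `|` C) x -> (B `|` C) y -> (B `|` C) x' ->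
    (B `|` C) y' -> k x y = k x' y' -> x = x' /\ y = y'.
  move=> Dx Dy Dx' Dy' /iinj e'.
  have {e'} : q (r x) (r y) = q (r x') (r y') by apply: e'; apply: qB; exact: rB.
  move=> /(qinj _ _ _ _ (rB _ Dx) (rB _ Dy) (rB _ Dx') (rB _ Dy'))[].
  by move=> /rinj -> // /rinj ->.
have domS : pairing_dom S = B `|` C.
  apply/seteqP; split=> [x [z [/Rdom[Bx _ _]|[]]]|x [[z Rz]|Cx]] //; first by left.
    by exists z; left.
  by exists (k x x); right; split=> //=; [right|right|move=> [/(CB _ Cx)]].
have SP : pairing A S.
  split; rewrite ?domS.
  - move=> x y z [/Rdom[? ? ?]|[/= Dx Dy _ ->]]; first by split; left.
    by split=> //; right; exact: kC.
  - move=> x y Dx Dy; have [[Bx By]|nB] := pselect (B x /\ B y).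
      by exists (q x y); left; exact: qP.
    by exists (k x y); right.
  - move=> x y z z' [Rz|[/= Dx Dy nB ->]] [Rz'|[/= Dx' Dy' nB' ->]] //.
    + exact: Rfun Rz Rz'.
    + by have [] := Rdom _ _ _ Rz => Bx By _; case: nB'.
    + by have [] := Rdom _ _ _ Rz' => Bx By _; case: nB.
  - move=> x y x' y' z [Rz|[/= Dx Dy nB ->]] [Rz'|[/= Dx' Dy' nB' e']].
    + exact: Rinj Rz Rz'.
    + by have [_ _] := Rdom _ _ _ Rz; rewrite e' => /(CB _ (kC _ _ Dx' Dy')).
    + by have [_ _] := Rdom _ _ _ Rz' => /(CB _ (kC _ _ Dx Dy)).
    + exact: kinj.
  - by move=> x [/RA//|[y /iAB[Ay _] <-]].
have SR : S `<=` R by apply: Rmax => // p Rp; left.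
have [b Bb] := infinite_setN0 Binf.
have Cib : C (i b) by exists b.
have : pairing_dom S (i b) by rewrite domS; right.
by move=> [z /SR Rz]; case: (CB _ Cib); exists z.
Qed.

Lemma card_le_setX_infinite T U (V : pointedType) (A : set T) (B : set U)
    (C : set V) :
  infinite_set C -> A #<= C -> B #<= C -> A `*` B #<= C.
Proof.
move=> Cinf AC BC; apply: card_le_trans (card_setX_self Cinf).
exact: card_le_setX.
Qed.

Lemma card_le_setU_infinite T (V : pointedType) (A B : set T) (C : set V) :
  infinite_set C -> A #<= C -> B #<= C -> A `|` B #<= C.
Proof.
move=> Cinf AC BC; apply: card_le_trans (card_setX_self Cinf).
have [f [fC finj]] := card_le_injE AC; have [g [gC ginj]] := card_le_injE BC.
have [e [eC einj]] := card_le_injE ((infiniteP C).1 Cinf).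
have {}eC i : C (e i) by exact: eC.
have e01 : e 0 <> e 1 by move=> /einj; move=> /(_ I I).
pose h x := if `[< A x >] then (e 0, f x) else (e 1, g x).
apply: (@card_le_inj _ _ _ _ h) => [x|x y]; rewrite /h.
  by case: asboolP => Ax [//|Bx]; split=> //=; [exact: fC|exact: fC|exact: gC].
case: asboolP => Ax Dx; case: asboolP => Ay Dy [].
- by move=> /finj; exact.
- by move=> /e01.
- by move=> /esym/e01.
- by case: Dx Dy => // Bx [//|By]; move=> /ginj; exact.
Qed.

(** Iterated pairing codes the entries, but is decodable only when the length is known; hence the
    length is paired with it. *)
Lemma card_le_seq (T : pointedType) (A : set T) : infinite_set A ->
  [set s : seq T | forall x, x \in s -> A x] #<= A.
Proof.
move=> Ainf; have [q [qA qinj]] := card_le_injE (card_setX_self Ainf).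
have [e [eA einj]] := card_le_injE ((infiniteP A).1 Ainf).
have {}eA i : A (e i) by exact: eA.
have {}einj i j : e i = e j -> i = j by move=> /einj; exact.
pose code := foldr (fun x y => q (x, y)) (e 0).
have codeA s : (forall x, x \in s -> A x) -> A (code s).
  elim: s => //= x s IHs sA; apply: qA; split=> /=; first exact/sA/mem_head.
  by apply: IHs => y ys; apply: sA; rewrite inE ys orbT.
apply: (@card_le_inj _ _ _ _ (fun s => q (e (size s), code s))) => [s sA|s t sA tA].
  by apply: qA; split; [exact: eA|exact: codeA].
have sA' : (A `*` A) (e (size s), code s) by split; [exact: eA|exact: codeA].
have tA' : (A `*` A) (e (size t), code t) by split; [exact: eA|exact: codeA].
move=> /(qinj _ _ sA' tA'){sA' tA'}[].
move=> /einj; elim: s t sA tA => [|x s IHs] [|y t] //= sA tA [sz].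
have [sA' tA'] : (forall z, z \in s -> A z) /\ (forall z, z \in t -> A z).
  by split=> z zs; [apply: sA|apply: tA]; rewrite inE zs orbT.
have xA : (A `*` A) (x, code s) by split; [exact/sA/mem_head|exact: codeA].
have yA : (A `*` A) (y, code t) by split; [exact/tA/mem_head|exact: codeA].
by move=> /(qinj _ _ xA yA)[-> /(IHs _ sA' tA' sz) ->].
Qed.

(** * Cells of independent families *)

Lemma cellP h x : cell h x <-> forall A b, h.[? A]%fmap = Some b -> spow A b x.
Proof.
split=> [hx A b|hx A _]; last by apply: hx; rewrite Some_fnd.
by case: fndP => // Ah [<-]; exact: (hx (Sub A Ah)).
Qed.

Lemma FFP I h : FF I h <-> forall A b, h.[? A]%fmap = Some b -> I A.
Proof.
split=> [hI A b|hI A Ah]; first by case: fndP => // Ah _; exact: hI.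
by apply: (hI A h.[Ah]%fmap); exact: in_fnd.
Qed.

Lemma fmap_of_seq (s : seq (set nat)) (c : set nat -> bool) :
  exists h : {fmap set nat -> bool},
    forall A b, h.[? A]%fmap = Some b <-> A \in s /\ c A = b.
Proof.
exists [fmap A : seq_fset tt s => c (val A)]%fmap => A b.
case: fndP => Ah; last by split=> // -[As _]; move: Ah; rewrite seq_fsetE As.
by rewrite ffunE /=; move: (Ah); rewrite seq_fsetE => As; split=> [[]|[_ ->]].
Qed.

Lemma seq_of_fmap (h : {fmap set nat -> bool}) :
  exists (s : seq (set nat)) (c : set nat -> bool),
    forall A b, h.[? A]%fmap = Some b <-> A \in s /\ c A = b.
Proof.
exists (domf h), (fun A => odflt false h.[? A]%fmap) => A b.
case: fndP => Ah /=; first by split=> [[]|[_ ->]].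
by split=> // -[Ah']; move: Ah; rewrite Ah'.
Qed.

Lemma independentP I : independent I <-> infinite_set I /\
  forall (s : seq (set nat)) (c : set nat -> bool),
    (forall A, A \in s -> I A) -> exists x, forall A, A \in s -> spow A (c A) x.
Proof.
split=> -[Iinf Iind]; split=> //.
  move=> s c sI; have [h hP] := fmap_of_seq s c.
  have [|x /cellP hx] := Iind h; first by apply/FFP => A b /hP[/sI].
  by exists x => A As; apply: hx; apply/hP.
move=> h /FFP hI; have [s [c hP]] := seq_of_fmap h.
have [|x xP] := Iind s c; first by move=> A As; apply: (hI A (c A)); apply/hP.
by exists x; apply/cellP => A b /hP[As <-]; exact: xP.
Qed.

Lemma infinite_not_mem (T : choiceType) (A : set T) (s : seq T) :
  infinite_set A -> exists2 x, A x & x \notin s.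
Proof.
move=> Ainf; apply: contrapT => nA; apply: Ainf.
apply: sub_finite_set (finite_seq s) => x Ax /=.
by apply: contrapT => /negP xs; apply: nA; exists x.
Qed.

Lemma cell_unbounded I (s : seq (set nat)) c N :
  independent I -> (forall A, A \in s -> I A) ->
  exists2 x, N <= x & forall A, A \in s -> spow A (c A) x.
Proof.
move=> /independentP[Iinf Iind] sI.
(* exclude 0, ..., N - 1 one by one, each by a new member of I *)
suff [x xP] : exists x, (N <= x /\ forall A, A \in s -> spow A (c A) x).
  by exists x; case: xP.
suff [s' [c' [s'I sub xN]]] : exists (s' : seq (set nat)) (c' : set nat -> bool),
    [/\ forall A, A \in s' -> I A,
    forall A, A \in s -> A \in s' /\ c' A = c A &
    forall x, x < N -> exists2 A, A \in s' & ~ spow A (c' A) x].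
  have [x xP] := Iind _ c' s'I; exists x; split.
    by rewrite leqNgt; apply/negP => /xN[A /xP].
  by move=> A As; have [/xP + <-] := sub _ As.
elim: N => [|N [s' [c' [s'I sub xN]]]]; first by exists s, c.
have [A IA As'] := infinite_not_mem s' Iinf.
(* As [true] stands for the complement, this sign for [A] excludes the point [N]. *)
exists (A :: s'), (fun B => if B == A then `[< A N >] else c' B); split.
- by move=> B; rewrite inE => /orP[/eqP->|/s'I].
- move=> B /sub[Bs' <-]; rewrite inE Bs' orbT; case: eqP => // BA.
  by rewrite -BA Bs' in As'.
- move=> x; rewrite ltnS leq_eqVlt => /orP[/eqP->|/xN[B Bs' nB]].
    exists A; first exact: mem_head.
    by rewrite eqxx; case: asboolP => [AN nAN|nAN]; [exact: nAN|].
  exists B; first by rewrite inE Bs' orbT.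
  by case: eqP => // BA; rewrite -BA Bs' in As'.
Qed.

(** A finite [h] leaves some [Y n] out of its domain; giving [Y n] the value [false] shrinks the
    cell into [Y n], hence into [A]. *)
Lemma Fil_infinite_range I A (Y : nat -> set nat) :
  (forall n, I (Y n)) -> infinite_set (range Y) -> (forall n, Y n `<=` A) ->
  Fil I A.
Proof.
move=> IY Yinf YA h hI.
have [s [c hP]] := seq_of_fmap h.
have [_ [n _ <-] Yns] := infinite_not_mem s Yinf.
have [k kP] := fmap_of_seq (Y n :: s) (fun B => if B == Y n then false else c B).
exists k; split.
- apply/FFP => B b /kP[+ _]; rewrite inE => /orP[/eqP->//|Bs].
  by move/FFP: hI => /(_ B (c B)); apply; apply/hP.
- move=> B b /hP[Bs <-]; apply/kP; rewrite inE Bs orbT; split=> //.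
  by case: eqP => // BY; rewrite -BY Bs in Yns.
- move=> x /cellP kx; apply: YA; apply: (kx (Y n) false).
  by apply/kP; rewrite mem_head eqxx.
Qed.

(** * Guessing sparse sets *)

(** Failure of [phi]-sparseness for a pair, whichever point is the smaller; when [n <= phi n], equal
    points conflict too. *)
Definition conflict (phi : nat -> nat) a x := (x <= a <= phi x) || (a <= x <= phi a).

Lemma count_le1 (T : Type) (r : rel T) (p : pred T) s :
  (forall x y, p x -> p y -> ~~ r x y) -> pairwise r s -> count p s <= 1.
Proof.
move=> pr; elim: s => //= x s IHs /andP[xs /IHs ps].
case px: (p x) => //; rewrite (_ : count p s = 0) //.
apply/eqP; rewrite -leqn0 leqNgt -has_count; apply/negP.
elim: s xs {IHs ps} => //= y s IHs /andP[rxy xs] /orP[py|]; last exact: IHs.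
by have := pr _ _ px py; rewrite rxy.
Qed.

(** At most one point [x] of the list lies below [a] with [phi x] reaching [a] and, [phi] being
    monotone, at most one lies between [a] and [phi a]. *)
Lemma conflict_count phi a s : {homo phi : x y / x <= y} ->
  pairwise (fun x y => phi x < y) s -> count (conflict phi a) s <= 2.
Proof.
move=> mono srt; pose p x := x <= a <= phi x; pose q x := a <= x <= phi a.
rewrite (eq_count (a2 := predU p q)) //.
apply: leq_trans (leq_addr (count (predI p q) s) _) _.
rewrite count_predUI -[2]/(1 + 1) leq_add //.
  apply: count_le1 srt => x y /andP[_ ax] /andP[ya _].
  by rewrite -leqNgt; exact: leq_trans ax.
apply: count_le1 srt => x y /andP[ax _] /andP[_ ya].
by rewrite -leqNgt (leq_trans ya) // mono.
Qed.

Lemma conflict_free_mem phi (P s : seq nat) : {homo phi : x y / x <= y} ->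
  pairwise (fun x y => phi x < y) s -> (size P).*2 < size s ->
  has (fun x => all (fun a => ~~ conflict phi a x) P) s.
Proof.
move=> mono; elim: P s => [|a P IHP] s srt; first by case: s {srt}.
rewrite /= doubleS => sz.
have /IHP : pairwise (fun x y => phi x < y) [seq x <- s | ~~ conflict phi a x].
  exact: subseq_pairwise (filter_subseq _ _) srt.
case/(_ _)/hasP => [|x].
  have := count_predC (conflict phi a) s; rewrite -size_filter => e.
  have := conflict_count a mono srt; rewrite size_filter.
  move: e sz; rewrite size_filter.
  set u := count _ _; set v := count _ _ => <- sz u2.
  rewrite -(ltn_add2l u); apply: leq_trans sz.
  by rewrite -addn2 addnC addSn ltnS leq_add2l.
by rewrite mem_filter => /andP[ax xs] Px; apply/hasP; exists x; rewrite ?ax.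
Qed.

(** Otherwise the functions [h k] would form an evading family indexed by [A], so of cardinality at
    least [frak_mc]. *)
Lemma guess (K : Type) (A : set K) (h : K -> nat -> nat) :
  frak_mc #= frak_d -> ~ (frak_d #<= A) ->
  exists g, forall k, A k -> exists n, g n = h k n.
Proof.
move=> md nA; apply: contrapT => /forallNP nog; apply: nA.
rewrite -(card_le_eql md); apply: card_le_trans (card_image_le h A).
apply: (proj2 frak_mcP) => g.
have /existsNP[k /not_implyP[Ak kP]] := nog g.
by exists (h k); [exists k|move=> n gn; apply: kP; exists n].
Qed.

Definition decode (T : countType) (t : T) (n : nat) : T :=
  odflt t (choice.unpickle n).

Lemma decodeK (T : countType) (t x : T) : decode t (choice.pickle x) = x.
Proof. by rewrite /decode choice.pickleK. Qed.

(** Each guess [g n] is a list of candidate points with one colour. Wrong guesses do no harm, since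
    a point is kept only if it conflicts with none before it. *)
Fixpoint greedy (phi : nat -> nat) (g : nat -> seq nat * nat) n : seq (nat * nat) :=
  if n isn't m.+1 then [::] else
  let P := greedy phi g m in
  let free x := all (fun a => ~~ conflict phi a x) (unzip1 P) in
  if has free (g m).1 then (nth 0 (g m).1 (find free (g m).1), (g m).2) :: P else P.

Lemma size_greedy phi g n : size (greedy phi g n) <= n.
Proof. by elim: n => //= n IHn; case: ifP => // _; exact: leqW. Qed.

Lemma greedy_sparse phi g n p q : p \in greedy phi g n -> q \in greedy phi g n ->
  p.1 <= q.1 -> p = q \/ phi p.1 < q.1.
Proof.
elim: n => //= n IHn; case: ifP => [/(nth_find 0)|_]; last exact: IHn.
set x := nth _ _ _ => /allP xP.
have {}xP a : a \in greedy phi g n -> ~~ conflict phi a.1 x.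
  by move=> ag; apply: xP; exact: map_f.
rewrite !inE => /orP[/eqP->|pg] /orP[/eqP->|qg] //=.
- by left.
- move=> xq; right; have := xP _ qg.
  by rewrite /conflict xq /= negb_or -ltnNge => /andP[].
- move=> px; right; have := xP _ pg.
  by rewrite /conflict px /= negb_or -ltnNge => /andP[].
- exact: IHn.
Qed.

Lemma greedy_head phi g n s c (free := fun x =>
    all (fun a => ~~ conflict phi a x) (unzip1 (greedy phi g n))) :
  g n = (s, c) -> has free s ->
  (nth 0 s (find free s), c) \in greedy phi g n.+1.
Proof. by rewrite /= => -> /= ->; rewrite mem_head. Qed.

Lemma greedy_sub phi g m n : m <= n -> {subset greedy phi g m <= greedy phi g n}.
Proof.
elim: n => [|n IHn]; first by rewrite leqn0 => /eqP->.
rewrite leq_eqVlt => /orP[/eqP->//|/IHn sub] p /sub pn /=.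
by case: ifP => // _; rewrite inE pn orbT.
Qed.

(* The n-th guess is a sparse list of 2n + 1 points of X k; each of the at most n
   points chosen before conflicts with at most two of them. *)
Lemma sparse_guess (K : Type) (A : set K) (X : K -> set nat) (col : K -> nat) phi :
  frak_mc #= frak_d -> ~ (frak_d #<= A) ->
  {homo phi : x y / x <= y} -> (forall n, n <= phi n) ->
  (forall k, A k -> forall N, exists2 x, N <= x & X k x) ->
  exists Q : set (nat * nat),
    (forall p q, Q p -> Q q -> p.1 <= q.1 -> p = q \/ phi p.1 < q.1) /\
    (forall k, A k -> exists2 x, X k x & Q (x, col k)).
Proof.
move=> md nA mono phi_ge Xunb.
have /choice[nx nxP] (p : K * nat) : exists x, A p.1 -> p.2 <= x /\ X p.1 x.
  have [Ak|nAk] := pselect (A p.1); last by exists 0.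
  by have [x px Xx] := Xunb _ Ak p.2; exists x.
pose u k i := iter i (fun x => nx (k, (phi x).+1)) (nx (k, 0)).
have uX k i : A k -> X k (u k i).
  move=> Ak; case: i => [|i] /=; first exact: (nxP (k, 0) _).2.
  exact: (nxP (k, _) _).2.
have u_sparse k : A k -> forall i j, i < j -> phi (u k i) < u k j.
  move=> Ak i; elim=> // j IHj; rewrite ltnS leq_eqVlt => ij.
  have uj : phi (u k j) < u k j.+1 by have [] := nxP (k, (phi (u k j)).+1) Ak.
  case/orP: ij => [/eqP->//|/IHj ij].
  by apply: leq_trans uj; apply: leq_trans ij _; exact/leqW.
pose list k n := mkseq (u k) n.*2.+1.
have [g gP] := guess (fun k n => choice.pickle (list k n, col k)) md nA.
pose g' n := decode ([::] : seq nat, 0) (g n).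
exists [set p | exists n, p \in greedy phi g' n]; split=> [p q [m pm] [n qn]|k Ak].
  by apply: (@greedy_sparse _ g' (maxn m n)); [move: pm|move: qn];
    apply: greedy_sub; rewrite ?leq_maxl ?leq_maxr.
have [n gn] := gP _ Ak.
have g'n : g' n = (list k n, col k) by rewrite /g' gn decodeK.
have : has (fun x => all (fun a => ~~ conflict phi a x) (unzip1 (greedy phi g' n)))
    (list k n).
  apply: conflict_free_mem => //.
    apply/(pairwiseP 0) => i j; rewrite !inE size_mkseq => il jl ij.
    by rewrite !nth_mkseq // u_sparse.
  by rewrite size_mkseq size_map ltnS leq_double size_greedy.
set free := (fun x => all _ _) => lfree.
exists (nth 0 (list k n) (find free (list k n))).
  by rewrite nth_mkseq; [exact: uX|move: lfree; rewrite has_find size_mkseq].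
by exists n.+1; exact: greedy_head.
Qed.

Definition sparse_extension (J : set (set nat)) (phi : nat -> nat)
    (Y : nat -> set nat) :=
  [/\ independent (J `|` range Y), infinite_set (range Y) &
    exists2 A : set nat, (forall x y, A x -> A y -> x < y -> phi x < y) &
      forall n, Y n `<=` A].

(* Every finite pattern of membership in the Y m is realised in every cell of J,
   on a phi-sparse set containing all the Y m. *)
Lemma sparse_extension_exists J phi :
  frak_mc #= frak_d -> independent J -> ~ (frak_d #<= J) ->
  {homo phi : x y / x <= y} -> (forall n, n <= phi n) ->
  exists Y, sparse_extension J phi Y.
Proof.
move=> md Jind nJ mono phi_ge; have [Jinf _] := Jind.
(* A key is a list of members of [J] with a number coding both the signs on that list and a finite
   list of indices, used as the colour. *)
pose bits (k : seq (set nat) * nat) :=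
  (decode ([::] : seq bool, [::] : seq nat) k.2).1.
pose sign k B := nth false (bits k) (index B k.1).
pose X k : set nat := [set x | forall B, B \in k.1 -> spow B (sign k B) x].
pose col (k : seq (set nat) * nat) :=
  choice.pickle (decode ([::] : seq bool, [::] : seq nat) k.2).2.
pose K := [set s : seq (set nat) | forall B, B \in s -> J B] `*` [set: nat].
have KJ : K #<= J.
  by apply: card_le_setX_infinite => //; [exact: card_le_seq|exact/infiniteP].
have [||Q [Q_sparse Q_hit]] := @sparse_guess _ K X col phi md _ mono phi_ge.
- by move=> /card_le_trans/(_ KJ).
- move=> k [kJ _] N; have [x Nx xP] := cell_unbounded (sign k) N Jind kJ.
  by exists x.
have Q_fun x n n' : Q (x, n) -> Q (x, n') -> n = n'.
  move=> a b; have [//|[]|/=] := Q_sparse _ _ a b => //.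
  by rewrite ltnNge phi_ge.
(* The colour of a point lists the indices [m] of the [Y m] containing it, so it prescribes all
   these memberships at once. *)
pose Y m := [set x | exists2 n, Q (x, n) & m \in decode ([::] : seq nat) n].
have key (s : seq (set nat)) c (t : seq nat) : (forall B, B \in s -> J B) ->
    exists x, (forall B, B \in s -> spow B (c B) x) /\ forall m, Y m x <-> m \in t.
  move=> sJ.
  have [|x xX xQ] := Q_hit (s, choice.pickle (map c s, t)); first by split.
  exists x; split=> [B Bs|m].
    have := xX B Bs; rewrite /sign /bits decodeK /= (nth_map set0) ?index_mem //.
    by rewrite nth_index.
  rewrite /col decodeK in xQ.
  by split=> [[n /(Q_fun _ _ _ xQ) <-]|mt]; [|exists (choice.pickle t)];
    rewrite ?decodeK.
have Yinj m m' : Y m = Y m' -> m = m'.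
  move=> e; have [//|x [_ xY]] := key [::] (fun=> true) [:: m].
  have /xY : Y m' x by rewrite -e; apply/xY; rewrite mem_head.
  by rewrite inE => /eqP.
exists Y; split; last first.
- exists [set x | exists n, Q (x, n)] => [x y [n xn] [n' yn'] xy|m x [n xn _]].
    by have [[e _]|//] := Q_sparse _ _ xn yn' (ltnW xy); rewrite e ltnn in xy.
  by exists n.
- by apply/infiniteP; apply: (@card_le_inj _ _ _ _ Y) => [m _|m m' _ _ /Yinj//];
    exists m.
apply/independentP; split.
  by apply: sub_infinite_set Jinf; exact: subsetUl.
move=> s c sJY.
have /choice[m mP] (B : set nat) : exists m, range Y B -> Y m = B.
  by have [[m _ e]|nB] := pselect (range Y B); [exists m|exists 0].
pose s1 := [seq B <- s | `[< J B >]].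
(* The value [false] asks for membership: [t] collects the indices of the [Y] that must contain
   [x]. *)
pose t := [seq m B | B <- s & `[< range Y B >] && ~~ c B].
have [B|x [xs1 xt]] := key s1 c t; first by rewrite mem_filter => /andP[/asboolP].
exists x => B Bs; have [JB|nJB] := pselect (J B).
  by apply: xs1; rewrite mem_filter Bs andbT; exact/asboolP.
have [//|rB] := sJY B Bs; case cB: (c B) => /=.
  rewrite -(mP _ rB) => /xt /mapP[B']; rewrite mem_filter.
  move=> /andP[/andP[/asboolP rB' cB'] _] e.
  by rewrite -(mP _ rB) e (mP _ rB') (negbTE cB') in cB.
rewrite -(mP _ rB); apply/xt/map_f; rewrite mem_filter Bs cB !andbT.
exact/asboolP.
Qed.

(** * Transfinite extension *)

Lemma independent_bigcup (F : set (set (set nat))) : F !=set0 ->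
  total_on F subset -> (forall I, F I -> independent I) ->
  independent (\bigcup_(I in F) I).
Proof.
move=> [I0 FI0] Ftot Find; apply/independentP; split.
  have [+ _] := Find _ FI0; apply: sub_infinite_set.
  exact: bigcup_sup.
move=> s c sF; suff [I FI sI] : exists2 I, F I & forall A, A \in s -> I A.
  by have /independentP[_] := Find _ FI; exact.
elim: s sF => [|A s IHs] sF; first by exists I0.
have [|I FI sI] := IHs; first by move=> B Bs; apply: sF; rewrite inE Bs orbT.
have [I' FI' AI'] := sF A (mem_head _ _).
have [II'|I'I] := Ftot _ _ FI FI'.
  by exists I' => // B; rewrite inE => /orP[/eqP->//|/sI/II'].
by exists I => // B; rewrite inE => /orP[/eqP->|/sI//]; exact: I'I.
Qed.

(** Summing successors gives a monotone function above both [f] and the identity, as sparse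
    extensions require. *)
Definition hull (f : nat -> nat) n := \sum_(i < n.+1) (f i).+1.

Lemma hull_homo f : {homo hull f : x y / x <= y}.
Proof.
move=> x y; rewrite /hull -ltnS => xy.
by rewrite -(subnKC xy) big_split_ord /= leq_addr.
Qed.

Lemma hull_ge f n : f n <= hull f n.
Proof. by rewrite /hull big_ord_recr /= (leq_trans (leqnSn _)) // leq_addl. Qed.

Lemma hull_ge_id f n : n <= hull f n.
Proof.
rewrite /hull; elim: n => // n IHn; rewrite big_ord_recr /=.
by rewrite addnS ltnS (leq_trans IHn) // leq_addr.
Qed.

Lemma finite_to_one_bound f : finite_to_one f ->
  exists g : nat -> nat, forall x y, f x = f y -> y <= g x.
Proof.
move=> ffin; suff /choice[g gP] x : exists b, forall y, f x = f y -> y <= b.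
  by exists g.
have /finite_seqP[s sP] := ffin (f x).
exists (\max_(i <- s) i) => y e.
have ys : y \in s by have : [set` s] y by rewrite -sP /= e.
by rewrite (big_rem y ys) leq_maxl.
Qed.

(** The type is well-ordered; [U] is the least initial segment at least as large as [D] or, if there
    is none, the whole type. *)
Lemma short_well_order (T : pointedType) (D : set T) :
  exists (lt : T -> T -> Prop) (U : set T),
    [/\ well_founded lt,
        forall x y z, lt x y -> lt y z -> lt x z,
        forall x y, x = y \/ lt x y \/ lt y x,
        D #<= U & forall t, U t ->
          [set s | lt s t] `<=` U /\ ~ (D #<= [set s | lt s t])].
Proof.
have [R Rwo] := well_ordering_principle T.
have minR (A : set T) : A !=set0 -> exists2 z, A z & forall y, A y -> R z y.
  move=> [x Ax]; have [|z [[zA zR] _]] := Rwo (mem A).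
    by exists x; apply/mem_set.
  by exists z; [exact/set_mem|move=> y Ay; apply: zR; exact/mem_set].
have Rwo' : wo_chain R predT by move=> A _; exact: Rwo.
have Rxx x : R x x by have := @wo_chain_reflexive _ _ _ Rwo' x isT.
have Ranti x y : R x y -> R y x -> x = y.
  by move=> xy yx; apply: (@wo_chain_antisymmetric _ _ _ Rwo' x y) => //; rewrite xy.
have Rtot x y : R x y \/ R y x.
  by have [|z [->|->] zR] := minR [set x; y]; [by exists x; left|left|right];
    apply: zR; [right|left].
have Rtrans x y z : R x y -> R y z -> R x z.
  move=> xy yz; have [|m [[->|->]|->] mR] := minR ([set x; y] `|` [set z]).
  - by exists x; left; left.
  - by apply: mR; right.
  - by rewrite (Ranti x y xy) //; apply: mR; left; left.
  - by rewrite -(Ranti y z yz) //; apply: mR; left; right.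
pose lt x y := R x y /\ x <> y.
have lt_trans x y z : lt x y -> lt y z -> lt x z.
  move=> [xy nxy] [yz nyz]; split; first exact: Rtrans yz.
  by move=> e; apply: nxy; apply: Ranti => //; rewrite e.
have lt_wf : well_founded lt.
  move=> x; apply: contrapT => nx.
  have [|z nz zR] := minR [set x | ~ Acc lt x]; first by exists x.
  apply: nz; constructor=> y [yz nyz]; apply: contrapT => ny.
  by apply: nyz; apply: Ranti => //; exact: zR.
have lt_tot x y : x = y \/ lt x y \/ lt y x.
  have [|nxy] := pselect (x = y); first by left.
  by right; have [xy|yx] := Rtot x y; [left|right]; split=> // /esym.
pose big := [set t | D #<= [set s | lt s t]].
have [/minR[t tbig tR]|nbig] := pselect (big !=set0).
  exists lt, [set s | lt s t]; split=> // u ut; split=> [s su|/tR tu].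
    exact: lt_trans ut.
  by have [ut' nut] := ut; apply: nut; exact: Ranti.
exists lt, setT; split=> // [|t _]; first exact: card_leT.
by split=> // Dt; apply: nbig; exists t.
Qed.

Definition stage (T : Type) (I : set (set nat)) (Y : T -> nat -> set nat)
    (V : set T) : set (set nat) :=
  I `|` \bigcup_(s in V) range (Y s).

(** A stage consists of [I] and countably many sets for each index in [V]; the larger of [I] and [V]
    is infinite and bounds it. *)
Lemma card_stage (I : set (set nat)) (T : pointedType) V Y
    U (E : set U) :
  infinite_set I -> ~ (E #<= I) -> ~ (E #<= V) ->
  ~ (E #<= @stage T I Y V).
Proof.
move=> Iinf nI nV EJ.
have WX : \bigcup_(s in V) range (Y s) #<= V `*` [set: nat].
  apply: card_le_trans (card_image_le (fun p => Y p.1 p.2) _).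
  by apply: subset_card_le => _ [s Vs [n _ <-]]; exists (s, n).
have [IV|VI] := card_le_total I V.
  have Vinf : infinite_set V by move=> /(card_le_finite IV).
  apply: nV; apply: card_le_trans EJ _; apply: card_le_setU_infinite => //.
  by apply: card_le_trans WX _; apply: card_le_setX_infinite => //; exact/infiniteP.
apply: nI; apply: card_le_trans EJ _; apply: card_le_setU_infinite => //.
by apply: card_le_trans WX _; apply: card_le_setX_infinite => //; exact/infiniteP.
Qed.

Section Stages.
Variables (T : pointedType) (lt : T -> T -> Prop) (I : set (set nat)).
Hypothesis lt_wf : well_founded lt.
Hypothesis lt_trans : forall x y z, lt x y -> lt y z -> lt x z.
Hypothesis lt_total : forall x y, x = y \/ lt x y \/ lt y x.

Let below t := [set s | lt s t].

(** The families reached after each [t] in [V] form, together with [I], a chain with union the stage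
    over [V]; adding [I] covers an empty [V]. *)
Lemma stage_independent (Y : T -> nat -> set nat) V : independent I ->
  (forall t, V t -> below t `<=` V) ->
  (forall t, V t -> independent (stage I Y (below t) `|` range (Y t))) ->
  independent (stage I Y V).
Proof.
move=> Iind Vdown Vind.
pose G t := stage I Y (below t) `|` range (Y t).
have -> : stage I Y V = \bigcup_(J in I |` (G @` V)) J.
  apply/seteqP; split=> [A [IA|[t Vt At]]|A [_ [->|[t Vt <-]]]].
  - by exists I => //; left.
  - by exists (G t); [right; exists t|right].
  - by left.
  - move=> [[|[s st As]]|At]; first by left.
      by right; exists s => //; exact: Vdown st.
    by right; exists t.
apply: independent_bigcup => [||_ [->//|[t Vt <-]]]; last exact: Vind.
  by exists I; left.
have GI t : I `<=` G t by move=> A IA; left; left.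
have Glt s t : lt s t -> G s `<=` G t.
  move=> st A [[IA|[r rs Ar]]|As]; left; first by left.
    by right; exists r => //; exact: lt_trans st.
  by right; exists s.
move=> _ _ [->|[s Vs <-]] [->|[t Vt <-]].
- by left.
- by left.
- by right.
- by have [->|[st|ts]] := lt_total s t; [left|left; exact: Glt|right; exact: Glt].
Qed.

Lemma stage_exists (phi : T -> nat -> nat) :
  frak_mc #= frak_d -> independent I -> ~ (frak_d #<= I) ->
  (forall t, {homo phi t : x y / x <= y}) -> (forall t n, n <= phi t n) ->
  exists Y : T -> nat -> set nat, forall t, ~ (frak_d #<= below t) ->
    sparse_extension (stage I Y (below t)) (phi t) (Y t).
Proof.
move=> md Iind nI mono phi_ge.
(* The recursion gives access only to the [Y s] with [lt s t], so the stage is written with proofs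
   of [lt s t]. *)
pose J t (Y : forall s, lt s t -> nat -> set nat) :=
  I `|` [set A | exists s (st : lt s t) n, A = Y s st n].
pose step t Y := xget (fun=> set0) [set Z | sparse_extension (@J t Y) (phi t) Z].
pose Y := Fix lt_wf (fun _ => nat -> set nat) step.
have YE t : Y t = step t (fun s _ => Y s).
  rewrite /Y Fix_eq // => x f g fg; congr step.
  by apply: functional_extensionality_dep => s; apply: functional_extensionality_dep.
have JE t : @J t (fun s _ => Y s) = stage I Y (below t).
  congr (_ `|` _); apply/seteqP; split=> [_ [s [st [n ->]]]|_ [s st [n _ <-]]].
    by exists s => //; exists n.
  by exists s, st, n.
exists Y; elim/(well_founded_ind lt_wf) => t IHt nt.
have nlt s : lt s t -> ~ (frak_d #<= below s).
  move=> st /card_le_trans; apply: contra_not nt; apply.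
  by apply: subset_card_le => r; move/lt_trans; exact.
have [||Z ZP] := @sparse_extension_exists (stage I Y (below t)) _ md _ _ (mono t)
  (phi_ge t).
- apply: stage_independent => // s st; first by move=> r /lt_trans; exact.
  by have [] := IHt s st (nlt s st).
- by have [Iinf _] := Iind; exact: card_stage.
by rewrite YE /step JE; apply: xgetPex; exists Z.
Qed.

End Stages.

(** A finite list is met by the diagonal function agreeing with its [n]-th member at [n]. *)
Lemma evading_infinite H : evading H -> infinite_set H.
Proof.
move=> Hev /finite_seqP[s sP].
have [h Hh hP] := Hev (fun n => nth id s n n).
have hs : h \in s by have : [set` s] h by rewrite -sP.
by apply: (hP (index h s)); rewrite nth_index.
Qed.

Lemma frak_mc_le_d : frak_mc #<= frak_d.
Proof.
apply: (proj2 frak_mcP) => g; have [f df gf] := (proj1 frak_dP) g.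
by exists f => // n e; have := gf n; rewrite e ltnn.
Qed.

(** * q-filters from the cardinal equality, and the weaker properties *)

Lemma q_filter_exist :
  frak_mc #= frak_d ->
  exist_d_generically (fun I => independent I /\ has_q_filter I).
Proof.
move=> md I Iind [_ nI].
have [lt [U [lt_wf lt_trans lt_total DU Usmall]]] := short_well_order frak_d.
have [j [jU jinj]] := card_le_injE DU.
(* Through [j] the indices carry the members of the dominating family [frak_d]; any other index
   carries an arbitrary function. *)
have /choice[f fP] t : exists f, forall F, frak_d F -> j F = t -> f = F.
  have [[F dF <-]|nF] := pselect (exists2 F, frak_d F & j F = t).
    by exists F => F' dF' /esym/jinj; exact.
  by exists id => F dF e; case: nF; exists F.
have [Y YP] := stage_exists lt_wf lt_trans lt_total md Iind nI
  (fun t => @hull_homo (f t)) (fun t => hull_ge_id (f t)).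
have Jind : independent (stage I Y U).
  by apply: (stage_independent lt_trans lt_total Iind) => t /Usmall[// _ /YP[]].
exists (stage I Y U); split; [by move=> A IA; left|split=> // g].
move=> /finite_to_one_bound[b bP].
have [F dF bF] := proj1 frak_dP b.
have [_ Yinf [A A_sparse YA]] := YP _ (Usmall _ (jU _ dF)).2.
exists A.
  apply: Fil_infinite_range YA => // n.
  by right; exists (j F); [exact: jU|exists n].
(* If [g x = g y], then [y <= b x < F x <= hull F x], whereas sparseness puts a point [y > x] above
   [hull F x]. *)
have inj_lt x y : A x -> A y -> g x = g y -> ~ x < y.
  move=> Ax Ay e /(A_sparse _ _ Ax Ay); rewrite (fP _ _ dF erefl).
  apply/negP; rewrite -leqNgt (leq_trans (bP _ _ e)) //.
  by rewrite (leq_trans (ltnW (bF x))) // hull_ge.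
move=> x y /set_mem Ax /set_mem Ay e.
case: (ltngtP x y) => // xy; exfalso; first exact: inj_lt Ax Ay e xy.
exact: inj_lt Ay Ax (esym e) xy.
Qed.

Lemma q_filter_everywhere I :
  independent I -> has_q_filter I -> everywhere_q_independent I.
Proof.
move=> Iind Iq; split=> // f h ffin hI.
have [A AF finj] := Iq f ffin; have [k [kI hk kA]] := AF h hI.
exists k; split=> // x y /set_mem kx /set_mem ky.
by apply: finj; apply/mem_set; exact: kA.
Qed.

Lemma everywhere_q_independentW I : everywhere_q_independent I -> q_independent I.
Proof.
move=> [Iind Iq]; split=> // f ffin.
have [|k [kI _ kinj]] := Iq f [fmap]%fmap ffin; last first.
  by exists (cell k) => //; exists k.
by apply/FFP => A b; rewrite fnd_fmap0.
Qed.

(** * A small family with no q-independent extension *)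

(** Otherwise the functions [psi k] would form a dominating family no larger than [A]. *)
Lemma not_dominating K (A : set K) (psi : K -> nat -> nat) :
  ~ (frak_d #<= A) -> exists b, forall k, A k -> exists n, psi k n <= b n.
Proof.
move=> nA; apply: contrapT => /forallNP nob; apply: nA.
apply: card_le_trans (card_image_le psi A); apply: (proj2 frak_dP) => b.
have /existsNP[k /not_implyP[Ak kP]] := nob b.
exists (psi k); first by exists k.
by move=> n; rewrite ltnNge; apply/negP => kn; apply: kP; exists n.
Qed.

(* The initial segment makes the codes of distinct functions eventually different. *)
Definition local_code (h : nat -> nat) (N i : nat) :=
  choice.pickle (mkseq h N, h (choice.pickle (N, i))).

Definition in_block (b : nat -> nat) N (t : seq nat) :=
  (size t == N) && all (fun m => m <= b N) t.

(* The value x at the points x encoding no member of a block keeps the map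
   finite-to-one. *)
Definition block_index b x :=
  let p := decode (0, [::] : seq nat) x in
  if (x == choice.pickle p) && in_block b p.1 p.2 then p.1 else x.

Definition hits b (h : nat -> nat) : set nat := [set x | exists N t i,
  [/\ x = choice.pickle (N, t), in_block b N t, i < N &
    nth 0 t i = local_code h N i]].

Lemma block_index_pickle b N (t : seq nat) :
  in_block b N t -> block_index b (choice.pickle (N, t)) = N.
Proof. by rewrite /block_index decodeK /= eqxx => ->. Qed.

Lemma block_index_finite_to_one b : finite_to_one (block_index b).
Proof.
(* The fibre over [N] lies in the finite [N]-th block together with the stray point [N]. *)
move=> N; pose F (u : N.-tuple 'I_(b N).+1) := choice.pickle (N, map val u).
apply: (@sub_finite_set _ _ ([set N] `|` range F)); last first.
  rewrite finite_setU; split; first exact: finite_set1.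
  exact/finite_image/finite_finset.
move=> x; rewrite /= /block_index; case: ifP => [|_ ?]; last by left.
case: (decode _ _) => [M t] /= /andP[/eqP-> /andP[/eqP szt /allP tb]] MN; right.
rewrite MN {M MN} in szt tb *.
have sz : size (map (@inord (b N)) t) == N by rewrite size_map szt.
exists (Tuple sz) => //; rewrite /F /= -map_comp map_id_in // => m /tb mb /=.
by rewrite inordK.
Qed.

(** One sequence of block [N] suffices. A position reserved for each [h] to be hit carries its code,
    all others the value [b N], larger than every code; a code contains the first [N] values, so it
    hits no other member of [L]. *)
Lemma hits_independent b (L : seq (nat -> nat)) (sg : (nat -> nat) -> bool) N :
  size L <= N ->
  (forall h h', h \in L -> h' \in L -> mkseq h N = mkseq h' N -> h = h') ->
  (forall h i, h \in L -> i < N -> local_code h N i < b N) ->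
  exists x, forall h, h \in L -> spow (hits b h) (sg h) x.
Proof.
move=> LN sep small; pose L_ i := nth id L i.
pose t := mkseq (fun i =>
  if (i < size L) && ~~ sg (L_ i) then local_code (L_ i) N i else b N) N.
have tb : in_block b N t.
  rewrite /in_block size_mkseq eqxx; apply/allP => m /mapP[i].
  rewrite mem_iota add0n => /andP[_ iN] ->; case: ifP => // /andP[iL _].
  by apply/ltnW/small => //; exact: mem_nth.
exists (choice.pickle (N, t)) => h hL; case sgh : (sg h) => /=.
  move=> [_ [_ [i [/(pcan_inj choice.pickleK)[<- <-] _ iN]]]].
  rewrite nth_mkseq //; case: ifP => [/andP[iL sgi]|_ e].
    move=> /(pcan_inj choice.pickleK)[/sep e _].
    by move: sgi; rewrite e ?sgh //; exact: mem_nth.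
  by have := small h i hL iN; rewrite -e ltnn.
have iL : index h L < size L by rewrite index_mem.
exists N, t, (index h L); split=> //; first exact: leq_trans LN.
by rewrite nth_mkseq ?(leq_trans iL) //= /L_ nth_index // sgh.
Qed.

(* A selector of the blocks is, block by block, a single function g. *)
Lemma selector_evaded b (E : set nat) : set_inj E (block_index b) ->
  exists g : nat -> nat, forall h, (forall m, g m <> h m) ->
    forall x, E x -> ~ hits b h x.
Proof.
move=> Einj.
(* If [m] codes [(N, i)], the entry at position [i] of the only sequence of block [N] in [E] is a
   code from which [h m] can be read. *)
pose hit m (h : nat -> nat) := exists N i t, [/\ m = choice.pickle (N, i),
  E (choice.pickle (N, t)), in_block b N t & nth 0 t i = local_code h N i].
have hit_eq m h h' : hit m h -> hit m h' -> h m = h' m.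
  move=> [N [i [t [-> Et tb ti]]]] [N' [i' [t' [e Et' tb' ti']]]].
  move: e Et' tb' ti' => /(pcan_inj choice.pickleK)[<- <-] Et' tb' ti'.
  have := Einj _ _ (mem_set Et) (mem_set Et').
  rewrite !block_index_pickle // => /(_ erefl) /(pcan_inj choice.pickleK)[tt'].
  by move: ti'; rewrite -tt' ti => /(pcan_inj choice.pickleK)[].
have /choice[g gP] m : exists y, forall h, hit m h -> y = h m.
  have [[h mh]|nh] := pselect (exists h, hit m h); last first.
    by exists 0 => h mh; case: nh; exists h.
  by exists (h m) => h' /(hit_eq _ _ _ mh).
exists g => h gh x Ex [N [t [i [xE tb iN ti]]]].
apply: (gh (choice.pickle (N, i))); apply: gP.
by exists N, i, t; split=> //; rewrite -xE.
Qed.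

(** Varying the value at 0 turns one function evading a given [g] into infinitely many. *)
Definition update0 (h : nat -> nat) c n := if n is 0 then c else h n.

(** Distinct functions of the list differ at some point, and the sum exceeds all the points so
    chosen. *)
Lemma separating_bound (L : seq (nat -> nat)) :
  exists r, size L <= r /\ forall N h h', r <= N -> h \in L -> h' \in L ->
    mkseq h N = mkseq h' N -> h = h'.
Proof.
have /choice[d dP] (p : (nat -> nat) * (nat -> nat)) :
    exists m, p.1 m = p.2 m -> p.1 = p.2.
  have [e|/existsNP[m nm]] := pselect (forall m, p.1 m = p.2 m).
    by exists 0 => _; exact/funext.
  by exists m.
exists (size L + \sum_(h <- L) \sum_(h' <- L) (d (h, h')).+1).
split=> [|N h h' rN hL h'L e]; first exact: leq_addr.
apply: (dP (h, h')) => /=; set m := d _.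
have mN : m < N.
  apply: leq_trans rN; apply: leq_trans (leq_addl _ _).
  by rewrite (big_rem h) //= (big_rem h') //= -addnA leq_addr.
by rewrite -(nth_mkseq 0 h mN) e nth_mkseq.
Qed.

Lemma frak_mc_eq_d : exist_d_generically q_independent -> frak_mc #= frak_d.
Proof.
move=> gen; apply/card_eqPle; split; first exact: frak_mc_le_d.
apply: contrapT => nD.
have [mc_ev _] := frak_mcP; have mc_inf := evading_infinite mc_ev.
pose H : set (nat -> nat) :=
  [set update0 p.1 p.2 | p in frak_mc `*` [set: nat]].
have Hmc : H #<= frak_mc.
  apply: card_le_trans (card_image_le _ _) _.
  by apply: card_le_setX_infinite => //; exact/infiniteP.
have upd_inj h : injective (update0 h) by move=> c c' /(congr1 (@^~ 0)).
have Hinf : infinite_set H.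
  have [h mh] := infinite_setN0 mc_inf.
  apply/infiniteP; apply: (@card_le_inj _ _ _ _ (update0 h)) => [c _|c c' _ _].
    by exists (h, c).
  exact: upd_inj.
have /choice[r rP] := separating_bound.
(* The sum bounds the codes of members of [L] in block [n + r L], which is long enough to separate
   them and to reserve a position for each. *)
pose psi (L : seq (nat -> nat)) n :=
  (\sum_(h <- L) \sum_(i < n + r L) local_code h (n + r L) i).+1.
have [|b0 b0P] := @not_dominating _ [set L | forall h, h \in L -> H h] psi.
  move=> /card_le_trans/(_ (card_le_seq Hinf)) /card_le_trans/(_ Hmc).
  exact: nD.
(* Partial sums carry the bound [psi L n <= b0 n] from [n] over to the block [n + r L]. *)
pose b n := \sum_(i < n.+1) b0 i.
have meet (L : seq (nat -> nat)) (sg : (nat -> nat) -> bool) :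
    (forall h, h \in L -> H h) ->
    exists x, forall h, h \in L -> spow (hits b h) (sg h) x.
  move=> /b0P[n nb]; have [szL sep] := rP L.
  apply: (@hits_independent _ _ _ (n + r L)).
  - by apply: leq_trans szL _; exact: leq_addl.
  - by move=> h h'; apply: sep; exact: leq_addl.
  - move=> h i hL iN; apply: (@leq_trans (psi L n)).
      rewrite ltnS (big_rem h) //= (bigD1 (Ordinal iN)) //= -addnA; exact: leq_addr.
    apply: leq_trans nb _; rewrite /b.
    have nN : n < (n + r L).+1 by rewrite ltnS leq_addr.
    by rewrite (bigD1 (Ordinal nN)) //= leq_addr.
have hits_inj h h' : H h -> H h' -> hits b h = hits b h' -> h = h'.
  move=> Hh Hh' e; apply: contrapT => nh.
  have [|x xP] := meet [:: h; h'] (fun k => `[< k = h >]).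
    by move=> k; rewrite !inE => /orP[/eqP->|/eqP->].
  have := xP h (mem_head _ _); rewrite asboolT //= e; apply.
  have := xP h'; rewrite !inE eqxx orbT => /(_ isT).
  by rewrite asboolF // => /esym.
pose I := hits b @` H.
have Iind : independent I.
  apply/independentP; split.
    move=> Ifin; apply: Hinf; apply: card_le_finite Ifin.
    apply: (@card_le_inj _ _ _ _ (hits b)); last exact: hits_inj.
    by move=> h Hh; exists h.
  move=> s c sI.
  have /choice[pre preP] (A : set nat) : exists h, I A -> H h /\ hits b h = A.
    have [[h Hh <-]|nI] := pselect (I A); first by exists h.
    by exists id.
  have [|x xP] := meet (map pre s) (fun h => c (hits b h)).
    by move=> _ /mapP[A /sI/preP[? _] ->].
  exists x => A As; have [_ e] := preP _ (sI _ As).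
  by have := xP (pre A) (map_f _ As); rewrite e.
have IH : I #<= H by exact: card_image_le.
have [|J [IJ [Jind Jq]]] := gen I Iind.
  split; first exact: card_le_trans IH (card_le_trans Hmc frak_mc_le_d).
  by move=> /card_le_trans/(_ IH)/card_le_trans/(_ Hmc).
have [_ [k kJ <-] kinj] := Jq _ (@block_index_finite_to_one b).
have [g gP] := selector_evaded kinj.
have [h mh gh] := mc_ev g.
have [s [c kP]] := seq_of_fmap k.
(* Values at 0 above [g 0] keep these functions evading [g]; as there are infinitely many such sets,
   one is outside the domain of [k]. *)
pose W := [set hits b (update0 h (g 0 + i).+1) | i in [set: nat]].
have Winf : infinite_set W.
  apply/infiniteP.
  apply: (@card_le_inj _ _ _ _ (fun i => hits b (update0 h (g 0 + i).+1))).
    by move=> i _; exists i.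
  move=> i j _ _ /hits_inj e.
  have /upd_inj[/addnI//] : update0 h (g 0 + i).+1 = update0 h (g 0 + j).+1.
  by apply: e; [exists (h, (g 0 + i).+1)|exists (h, (g 0 + j).+1)].
have [_ [i _ <-] is_] := infinite_not_mem s Winf.
set h' := update0 h _ in is_.
have gh' m : g m <> h' m.
  case: m => [|m]; last exact: gh.
  by move=> /eqP; rewrite /h' /= ltn_eqF // ltnS leq_addr.
(* Independence of [J] puts a point of [cell k] into the set of [h'], contrary to the choice of
   [g]. *)
have /independentP[_ Jind'] := Jind.
have [|x xP] := Jind' (hits b h' :: s)
  (fun A => if A == hits b h' then false else c A).
  move=> A; rewrite inE => /orP[/eqP->|As].
    by apply: IJ; exists h' => //; exists (h, (g 0 + i).+1).
  by move/FFP: kJ => /(_ A (c A)); apply; exact/kP.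
apply: (gP h' gh' x).
  apply/cellP => A B /kP[As <-].
  have := xP A; rewrite inE As orbT => /(_ isT).
  by case: eqP => // e; rewrite -e As in is_.
by have := xP _ (mem_head _ _); rewrite eqxx.
Qed.

Theorem theorem3 :
  [<-> (frak_mc #= frak_d)%card;
       exist_d_generically (fun I => independent I /\ has_q_filter I);
       exist_d_generically everywhere_q_independent;
       exist_d_generically q_independent].
Proof.
tfae.
- exact: q_filter_exist.
- move=> gen I Iind Ismall; have [J [IJ [Jind Jq]]] := gen I Iind Ismall.
  by exists J; split=> //; exact: q_filter_everywhere.
- move=> gen I Iind Ismall; have [J [IJ Jq]] := gen I Iind Ismall.
  by exists J; split=> //; exact: everywhere_q_independentW.
- exact: frak_mc_eq_d.
Qed.
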